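(* For $n \ge 0$ let $R(n)$ be the largest positive integer that can be reached from $1$ by applying the Choix de Bruxelles operation exactly $n$ times (in succession). Define $r(0) = 1$ and, for $n > 0$, let $r(n)$ be the largest number that can be obtained by applying one Choix de Bruxelles operation to $r(n-1)$. Then $R(n) = r(n)$ for all $n \ge 0$ with $n \neq 7$, and $R(7) = 512$.
   Context: The Choix de Bruxelles operation: given a positive integer $n$ with decimal expansion $d_1 d_2 \ldots d_k$, choose indices $1 \le p \le q \le k$ with $d_p \neq 0$, let $s$ be the number with decimal representation $d_p d_{p+1}\ldots d_q$, and replace this substring in situ by the decimal expansion of $2s$, or, if $s$ is even, by the decimal expansion of $s/2$. One may also leave $n$ unchanged (empty substring). (For reference, $r(0),\ldots,r(7) = 1,2,4,8,16,112,224,448$.) *)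

(* Defs.v *)
From mathcomp Require Import all_boot.

Set Implicit Arguments.
Unset Strict Implicit.
Unset Printing Implicit Defensive.

(* Decimal expansions are lists of digits, most significant digit first. *)

Definition num (ds : seq nat) : nat := foldl (fun a d => 10 * a + d) 0 ds.

Fixpoint digits_rec (fuel n : nat) : seq nat :=
  if fuel is fuel'.+1 then
    if n == 0 then [::] else rcons (digits_rec fuel' (n %/ 10)) (n %% 10)
  else [::].

(* No leading zeros; digits 0 = [::], but below [digits] is only ever applied
   to positive numbers. *)
Definition digits (n : nat) : seq nat := digits_rec n n.

Definition double_or_halve (s : nat) : seq nat :=
  if odd s then [:: s.*2] else [:: s.*2; s./2].

(* Positions are counted from 0: the chosen substring of [ds] is
   ds_p, ..., ds_q, with p <= q < size ds. *)
Definition choix_at (ds : seq nat) (p q : nat) : seq nat :=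
  if nth 0 ds p == 0 then [::] else
  [seq num (take p ds ++ digits t ++ drop q.+1 ds)
     | t <- double_or_halve (num (take (q.+1 - p) (drop p ds)))].

(* All the results of one operation on n; the head n is the empty choice. *)
Definition choix (n : nat) : seq nat :=
  let ds := digits n in
  n :: flatten [seq choix_at ds p q
                  | p <- iota 0 (size ds), q <- iota p (size ds - p)].

Fixpoint reached (n : nat) : seq nat :=
  if n is n'.+1 then undup (flatten [seq choix m | m <- reached n'])
  else [:: 1].

Definition R (n : nat) : nat := \max_(m <- reached n) m.

Fixpoint r (n : nat) : nat :=
  if n is n'.+1 then \max_(m <- choix (r n')) m else 1.

Lemma num_rcons ds d : num (rcons ds d) = 10 * num ds + d.
Proof. by rewrite /num -cats1 foldl_cat. Qed.

Lemma digits_recP fuel n : n <= fuel ->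
  [/\ num (digits_rec fuel n) = n, all (fun d => d < 10) (digits_rec fuel n)
    & 0 < n -> head 0 (digits_rec fuel n) != 0].
Proof.
elim: fuel n => [|fuel IH] n; first by rewrite leqn0 => /eqP->.
rewrite /=; case: eqP => [->|/eqP]; first by [].
rewrite -lt0n => n_gt0 le_n.
have le_q : n %/ 10 <= fuel.
  by rewrite -ltnS; apply: leq_trans le_n; apply: ltn_Pdiv.
have [h1 h2 h3] := IH _ le_q.
split=> [||_]; first by rewrite num_rcons h1 mulnC -divn_eq.
- by rewrite all_rcons h2 ltn_mod.
have [q0|q_gt0] := posnP (n %/ 10); last first.
  have := h3 q_gt0.
  by case: (digits_rec fuel (n %/ 10)).
rewrite q0; have -> : digits_rec fuel 0 = [::] by case: (fuel).
have := divn_eq n 10; rewrite q0 mul0n add0n /= => <-.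
by rewrite -lt0n.
Qed.

Lemma digitsP n :
  [/\ num (digits n) = n, all (fun d => d < 10) (digits n)
    & 0 < n -> head 0 (digits n) != 0].
Proof. exact: digits_recP. Qed.

Lemma choixP n m : reflect
  (m = n \/ exists p q : nat,
     let ds := digits n in let s := num (take (q.+1 - p) (drop p ds)) in
     [/\ p <= q, q < size ds, nth 0 ds p != 0
       & m = num (take p ds ++ digits (2 * s) ++ drop q.+1 ds) \/
         (2 %| s /\ m = num (take p ds ++ digits (s %/ 2) ++ drop q.+1 ds))])
  (m \in choix n).
Proof.
rewrite /choix inE; apply: (iffP orP) => [[/eqP|/flattenP[l]]|[->|]];
  [by left | | by left; rewrite eqxx |].
- case/allpairsPdep=> p [q [hp hq ->]]; rewrite /choix_at.
  case: eqP => // /eqP nz /mapP[t ht ->]; right; exists p, q => /=.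
  move: hp hq; rewrite !mem_iota add0n => /andP[_ hp].
  rewrite subnKC ?(ltnW hp) // => /andP[le_pq hq]; split=> //.
  move: ht; rewrite /double_or_halve dvdn2 mul2n divn2; case: ifP => _ /=.
    by rewrite inE => /eqP->; left.
  by rewrite !inE => /orP[]/eqP->; [left | right].
move=> [p [q [le_pq hq nz hm]]]; right; apply/flattenP.
exists (choix_at (digits n) p q).
  apply/allpairsPdep; exists p, q; have hp := leq_ltn_trans le_pq hq.
  by rewrite !mem_iota add0n subnKC ?(ltnW hp) // hp le_pq hq.
rewrite /choix_at (negPf nz); apply/mapP; move: hm.
rewrite /double_or_halve dvdn2 mul2n divn2.
set s := num (take _ _).
case=> [->|[ev ->]]; last first.
  by rewrite (negPf ev); exists s./2; rewrite ?inE ?eqxx ?orbT.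
by exists s.*2 => //; case: ifP; rewrite !inE eqxx.
Qed.

Lemma bigmax_largest (s : seq nat) : s != [::] ->
  \max_(m <- s) m \in s /\ forall m, m \in s -> m <= \max_(m <- s) m.
Proof.
move=> s_neq0; split; last by move=> m ms; exact: (@leq_bigmax_seq _ s xpredT id m).
elim: s s_neq0 => //= x s IH _; rewrite big_cons.
case: s IH => [|y s] IH; first by rewrite big_nil maxn0 inE.
rewrite inE /maxn; case: ifP => _; first by rewrite IH ?orbT.
by rewrite eqxx.
Qed.

Lemma reachedS n m :
  (m \in reached n.+1) <-> exists2 k, k \in reached n & m \in choix k.
Proof.
rewrite /= mem_undup; split=> [/flattenP[_ /mapP[k hk ->] hm]|[k hk hm]].
  by exists k.
by apply/flattenP; exists (choix k) => //; apply: map_f.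
Qed.

Lemma R_largest n :
  R n \in reached n /\ forall m, m \in reached n -> m <= R n.
Proof.
apply: bigmax_largest.
have : 1 \in reached n; last by case: (reached n).
elim: n => // n IH; apply/reachedS; exists 1 => //; exact: mem_head.
Qed.

Lemma r_largest n :
  r n.+1 \in choix (r n) /\ forall m, m \in choix (r n) -> m <= r n.+1.
Proof. exact: bigmax_largest. Qed.

Lemma r_first : map r (iota 0 8) = [:: 1; 2; 4; 8; 16; 112; 224; 448].
Proof. by rewrite /= unlock; vm_compute. Qed.

(* Main.v *)
(** One operation lengthens a number by at most one digit, and only by doubling
    a substring that starts with a digit >= 5, which then becomes 1.  A finite
    computation shows that 10 operations give at most 5 digits; hence a number
    of the maximal length k + 5 reached after k + 10 operations has been
    lengthened at each of the last k steps.

    The greedy sequence has period 4 up to a prefix 8112: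
      r(4j+10) = (8112)^j 88224,    r(4j+11) = (8112)^j 816448,
      r(4j+12) = (8112)^j 8164416,  r(4j+13) = (8112)^j 81644112.
    A string that is lexicographically below the infinite word 81128112...
    remains so under lengthening steps, since at the first position that
    matters a digit is kept or drops to 1.  The strings that are not below this
    word have the form (8112)^j a with a in one of four finite sets (according
    to the number of steps modulo 4) that are mapped cyclically into each
    other, up to low strings; their largest elements are those of r. *)

Require Import Defs.
From mathcomp Require Import all_boot zify.

(** * Digit strings and their values *)

Definition isdigits (w : seq nat) := all (fun d => d < 10) w.

Lemma isdigits_cat v w : isdigits (v ++ w) = isdigits v && isdigits w.
Proof. exact: all_cat. Qed.

Fixpoint strip0 (w : seq nat) : seq nat :=
  if w is 0 :: w' then strip0 w' else w.

Lemma foldl_num a w :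
  foldl (fun a d => 10 * a + d) a w = a * 10 ^ size w + num w.
Proof.
elim: w a => [|d w IH] a; first by rewrite muln1 addn0.
by rewrite /num /= !IH expnS; lia.
Qed.

Lemma num_cons d w : num (d :: w) = d * 10 ^ size w + num w.
Proof. by rewrite {1}/num /= foldl_num. Qed.

Lemma num_lt w : isdigits w -> num w < 10 ^ size w.
Proof.
elim: w => // d w IH /= /andP[hd /IH hw].
by rewrite num_cons expnS; move: (10 ^ size w) hw => b hw; nia.
Qed.

Lemma num_strip0 w : num (strip0 w) = num w.
Proof. by elim: w => // -[|d] w IH //=; rewrite IH num_cons mul0n. Qed.

Lemma isdigits_strip0 w : isdigits w -> isdigits (strip0 w).
Proof. by elim: w => // -[|d] w. Qed.

Lemma size_strip0 w : size (strip0 w) <= size w.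
Proof. by elim: w => // -[|d] w IH //=; apply: leqW. Qed.

Lemma strip0_id w : head 0 w != 0 -> strip0 w = w.
Proof. by case: w => // -[]. Qed.

Lemma num_ge w : head 0 w != 0 -> 10 ^ (size w).-1 <= num w.
Proof.
case: w => //= d w hd; rewrite num_cons.
by move: (10 ^ size w) => b; case: d hd => // d _; rewrite mulSn; lia.
Qed.

Lemma num_inj v w : isdigits v -> isdigits w -> size v = size w ->
  num v = num w -> v = w.
Proof.
elim: v w => [|d v IH] [|e w] //= /andP[hd hv] /andP[he hw] [sz].
rewrite !num_cons sz => E.
have [lv lw] := (num_lt _ hv, num_lt _ hw); rewrite sz in lv.
have Ede : d = e by move: (10 ^ size w) E lv lw => b; nia.
by rewrite Ede; congr cons; apply: IH => //; move: E; rewrite Ede; lia.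
Qed.

Lemma size_num v w : isdigits w -> head 0 v != 0 -> num v <= num w ->
  size v <= size w.
Proof.
move=> hw hv le; case: v hv le => // d v hv le.
have := leq_ltn_trans (leq_trans (num_ge _ hv) le) (num_lt _ hw).
by rewrite ltn_exp2l.
Qed.

Lemma digits_isdigits n : isdigits (digits n).
Proof. by case: (digitsP n). Qed.

Lemma head_digits n : 0 < n -> head 0 (digits n) != 0.
Proof. by case: (digitsP n). Qed.

Lemma num_digits n : num (digits n) = n.
Proof. by case: (digitsP n). Qed.

Lemma head_strip0 w : (strip0 w == [::]) || (head 0 (strip0 w) != 0).
Proof. by elim: w => // -[|d] w. Qed.

(** Two strings without leading zeros and with the same value have the same length, and at equal
    length the value determines the digits. *)
Lemma digits_num w : isdigits w -> digits (num w) = strip0 w.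
Proof.
move=> hw; have hs := isdigits_strip0 _ hw.
rewrite -(num_strip0 w); case/orP: (head_strip0 w) => [/eqP->//|hh].
have gt0 : 0 < num (strip0 w) by apply: leq_trans (num_ge _ hh); rewrite expn_gt0.
have hd := digits_isdigits (num (strip0 w)).
have hh' := head_digits _ gt0.
have E := num_digits (num (strip0 w)).
by apply: num_inj => //; apply/eqP; rewrite eqn_leq !size_num ?E.
Qed.

Lemma digits_numK w : isdigits w -> head 0 w != 0 -> digits (num w) = w.
Proof. by move=> hw hh; rewrite digits_num // strip0_id. Qed.

(** * Doubling and halving of digit strings *)

(** Schoolbook doubling, with the outgoing carry as first component. Working digit by digit keeps
    all unary numbers below 20, so that the finite enumerations can be computed. *)
Fixpoint dblc (w : seq nat) : nat * seq nat :=
  if w is d :: w' then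
    let: (c, v) := dblc w' in ((d.*2 + c) %/ 10, (d.*2 + c) %% 10 :: v)
  else (0, [::]).

Definition dbl w := strip0 ((dblc w).1 :: (dblc w).2).

Fixpoint hlvc (c : nat) (w : seq nat) : seq nat :=
  if w is d :: w' then (10 * c + d) %/ 2 :: hlvc ((10 * c + d) %% 2) w'
  else [::].

Definition hlv w := strip0 (hlvc 0 w).

(** An incoming carry is 0 or 1, so [d.*2 + c] reaches 10 exactly when [d] is at least 5, whatever
    the carry. *)
Lemma dblcP w : isdigits w ->
  [/\ isdigits (dblc w).2, (dblc w).1 = (4 < head 0 w), size (dblc w).2 = size w
    & num ((dblc w).1 :: (dblc w).2) = 2 * num w].
Proof.
elim: w => // d w IH /= /andP[hd /IH].
case: (dblc w) => c v /= [hv hc sz]; rewrite !num_cons /= sz => E.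
have c1 : c < 2 by rewrite hc; case: (4 < _).
split; [by rewrite hv ltn_mod | by lia | by [] |].
have := divn_eq (d.*2 + c) 10.
by move: (_ %/ 10) (_ %% 10) => x y Exy; rewrite expnS; move: (10 ^ _) E => b; nia.
Qed.

Lemma digits_dbl w : isdigits w -> digits (2 * num w) = dbl w.
Proof.
move=> /dblcP[hd hc _ <-]; rewrite digits_num //= hc.
by case: (4 < _).
Qed.

Lemma hlvcP c w : c < 2 -> isdigits w ->
  [/\ isdigits (hlvc c w), size (hlvc c w) = size w
    & num (hlvc c w) = (c * 10 ^ size w + num w) %/ 2].
Proof.
elim: w c => [|d w IH] c hc; first by rewrite /num /= muln1; case: c hc => [|[]].
move=> /= /andP[hd hw].
have [||h1 h2 h3] := IH ((10 * c + d) %% 2); [exact: ltn_mod | by [] |].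
split; [by rewrite h1 andbT; lia | by rewrite h2 |].
rewrite !num_cons h2 h3 expnS; have := divn_eq (10 * c + d) 2.
move: (_ %/ 2) (_ %% 2) => x y Exy; move: (10 ^ _) => b.
have -> : c * (10 * b) + (d * b + num w) = x * b * 2 + (y * b + num w) by nia.
by rewrite divnMDl.
Qed.

Lemma digits_hlv w : isdigits w -> digits (num w %/ 2) = hlv w.
Proof.
by move=> /(@hlvcP 0)[]// hd _ E; rewrite /hlv -digits_num // E mul0n.
Qed.

Lemma size_hlv w : isdigits w -> size (hlv w) <= size w.
Proof.
by move=> /(@hlvcP 0)[]// _ sz _; apply: leq_trans (size_strip0 _) _; rewrite sz.
Qed.

Lemma size_dbl w : isdigits w -> head 0 w != 0 ->
  size (dbl w) = (4 < head 0 w) + size w.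
Proof.
move=> hw hh; have [hd hc sz E] := dblcP _ hw.
rewrite /dbl hc; case: ltnP => h4 /=; first by rewrite sz.
(* Only the zero carry is stripped: the next digit is [d.*2 + c] with [d] between 1 and 4, hence
   nonzero. *)
rewrite strip0_id ?sz //.
case: w hw hh hc h4 {sz E hd} => // d w /= /andP[hd hw] d0.
have [_ + _ _] := dblcP _ hw; case: (dblc w) => c v /= hc _ h4.
have c_lt2 : c < 2 by rewrite hc; case: (4 < _).
by lia.
Qed.

Lemma odd_num w : odd (num w) = odd (last 0 w).
Proof.
case: (lastP w) => // v d; rewrite num_rcons last_rcons oddD oddM.
by [].
Qed.

(** * The operation on digit strings *)

(** The recursion runs over the start of the replaced substring; [q] is its length minus one, so the
    substring is never empty. *)
Fixpoint subst_sub (f : seq nat -> seq (seq nat)) (w : seq nat) :=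
  if w is d :: w' then
    flatten [seq [seq y ++ drop q w' | y <- f (d :: take q w')]
               | q <- iota 0 (size w)]
    ++ [seq d :: x | x <- subst_sub f w']
  else [::].

Lemma subst_sub_cons f d w : subst_sub f (d :: w) =
  flatten [seq [seq y ++ drop q w | y <- f (d :: take q w)]
             | q <- iota 0 (size w).+1]
  ++ [seq d :: x | x <- subst_sub f w].
Proof. by []. Qed.

Lemma mem_subst_sub f a s b y : s != [::] -> y \in f s ->
  a ++ y ++ b \in subst_sub f (a ++ s ++ b).
Proof.
move=> s0 ys; elim: a => [|d a IH].
  2: by rewrite !cat_cons subst_sub_cons mem_cat (map_f (cons d)) ?orbT.
case: s s0 ys => // d s _ ys.
rewrite cat0s cat_cons subst_sub_cons mem_cat; apply/orP; left; apply/flattenP.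
exists [seq y ++ drop (size s) (s ++ b) | y <- f (d :: take (size s) (s ++ b))].
  apply: (map_f (fun q => [seq y ++ drop q (s ++ b) | y <- f (d :: take q (s ++ b))])).
  by rewrite mem_iota /= add0n ltnS size_cat leq_addr.
by rewrite take_size_cat // drop_size_cat //; apply: (map_f (cat^~ b)).
Qed.

Definition halves_doubles (s : seq nat) :=
  if head 0 s == 0 then [::]
  else if odd (last 0 s) then [:: dbl s] else [:: dbl s; hlv s].

Definition growth (s : seq nat) := if 4 < head 0 s then [:: dbl s] else [::].

Definition dchoix w := w :: subst_sub halves_doubles w.

Definition grow w := subst_sub growth w.

Lemma num_gt0 w : head 0 w != 0 -> 0 < num w.
Proof. by move=> h; apply: leq_trans (num_ge _ h); rewrite expn_gt0. Qed.

Lemma choix_digits n m : 0 < n -> m \in choix n ->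
  0 < m /\ (m = n \/ exists a s b, [/\ digits n = a ++ s ++ b, head 0 s != 0
    & digits m = a ++ dbl s ++ b \/
      ~~ odd (last 0 s) /\ digits m = a ++ hlv s ++ b]).
Proof.
move=> n_gt0 /choixP[->|[p [q]]]; first by split; [|left].
move=> /=; set ds := digits n; set s := take (q.+1 - p) _ => -[le_pq lt_q nz hm].
set a := take p ds in hm; set b := drop q.+1 ds in hm.
have Eds : ds = a ++ s ++ b.
  rewrite -[LHS](cat_take_drop p) -[drop p _](cat_take_drop (q.+1 - p)).
  by rewrite drop_drop subnK // ltnW.
have hs0 : head 0 s != 0.
  by rewrite -nth0 nth_take ?subn_gt0 // nth_drop addn0.
have := digits_isdigits n; rewrite -/ds Eds !isdigits_cat.
case/and3P=> ha hs hb.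
(* A positive replacement creates no leading zero, so the new string is itself the decimal expansion
   of its value. *)
have canon t : 0 < t ->
    0 < num (a ++ digits t ++ b) /\
    digits (num (a ++ digits t ++ b)) = a ++ digits t ++ b.
  move=> t_gt0.
  have hh : head 0 (a ++ digits t ++ b) != 0.
    have := head_digits _ n_gt0; rewrite -/ds Eds.
    by case: (a) => //= _; have := head_digits _ t_gt0; case: (digits t).
  split; first exact: num_gt0.
  apply: digits_numK => //.
  by rewrite !isdigits_cat ha hb digits_isdigits.
have s_gt0 := num_gt0 _ hs0.
case: hm => [->|[ev ->]].
- have [|? Em] := canon (2 * num s); first by rewrite muln_gt0.
  split=> //; right; exists a, s, b; split=> //; left.
  by rewrite Em digits_dbl.
- have [|? Em] := canon (num s %/ 2).
    by rewrite divn_gt0 // dvdn_leq.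
  split=> //; right; exists a, s, b; split=> //; right; split.
    by rewrite -odd_num -dvdn2.
  by rewrite Em digits_hlv.
Qed.

Lemma nonnil_head w : head 0 w != 0 -> w != [::].
Proof. by case: w. Qed.

Lemma choix_dchoix n m : 0 < n -> m \in choix n ->
  digits m \in dchoix (digits n).
Proof.
move=> n_gt0 /(choix_digits _ _ n_gt0)[_ [->|]]; first exact: mem_head.
move=> [a [s [b [-> hs hm]]]]; rewrite inE; apply/orP; right.
case: hm => [->|[ev ->]]; apply: mem_subst_sub; rewrite ?nonnil_head //.
- by rewrite /halves_doubles (negPf hs); case: ifP; rewrite !inE eqxx.
- by rewrite /halves_doubles (negPf hs) (negPf ev) !inE eqxx orbT.
Qed.

(** Halving never lengthens, and doubling does so only when the leading digit exceeds 4; these are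
    the replacements collected in [grow]. *)
Lemma choix_size n m : 0 < n -> m \in choix n ->
  size (digits m) <= (size (digits n)).+1 /\
  (size (digits m) = (size (digits n)).+1 -> digits m \in grow (digits n)).
Proof.
move=> n_gt0 /(choix_digits _ _ n_gt0)[_ [->|]]; first by split; lia.
move=> [a [s [b [En hs hm]]]].
have := digits_isdigits n; rewrite En !isdigits_cat => /and3P[_ ds _].
case: hm => [->|[_ ->]]; rewrite !size_cat; last first.
  by have := size_hlv _ ds; split; lia.
rewrite size_dbl //; split; first by case: (4 < _); lia.
move=> sz; apply: mem_subst_sub; first exact: nonnil_head.
by rewrite /growth; case: ifP sz; rewrite ?inE //; lia.
Qed.

Lemma choix_dbl a s b : isdigits (a ++ s ++ b) -> head 0 (a ++ s ++ b) != 0 ->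
  head 0 s != 0 -> num (a ++ dbl s ++ b) \in choix (num (a ++ s ++ b)).
Proof.
move=> hd hh hs; apply/choixP; right; exists (size a), (size a + (size s).-1).
have s_gt0 : 0 < size s by case: (s) hs.
have Eb : drop (size a + size s) (a ++ s ++ b) = b.
  by rewrite catA drop_size_cat // size_cat.
rewrite /= digits_numK // -addnS prednK // addKn Eb.
rewrite drop_size_cat // take_size_cat // take_size_cat //.
split; [by rewrite leq_addr | by rewrite !size_cat; lia | | left].
  by rewrite nth_cat ltnn subnn nth_cat s_gt0 nth0.
rewrite digits_dbl //.
by move: hd; rewrite !isdigits_cat => /and3P[].
Qed.

(** * Enumeration of the reachable digit strings *)

Fixpoint dreached (n : nat) : seq (seq nat) :=
  if n is n'.+1 then undup (flatten [seq dchoix w | w <- dreached n'])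
  else [:: [:: 1]].

Lemma reached_gt0 n m : m \in reached n -> 0 < m.
Proof.
elim: n m => [|n IH] m; first by rewrite inE => /eqP->.
by move=> /reachedS[k /IH k_gt0 /(choix_digits _ _ k_gt0)[]].
Qed.

Lemma reached_dreached n m : m \in reached n -> digits m \in dreached n.
Proof.
elim: n m => [|n IH] m; first by rewrite inE => /eqP->.
move=> /reachedS[k hk hm]; rewrite /= mem_undup; apply/flattenP.
exists (dchoix (digits k)); first exact: map_f (IH _ hk).
exact: choix_dchoix (reached_gt0 _ _ hk) hm.
Qed.

(** * Comparison of digit strings *)

Fixpoint lexle (v w : seq nat) : bool :=
  if (v, w) is (d :: v', e :: w') then (d < e) || (d == e) && lexle v' w'
  else true.

Definition strle v w :=
  (size v < size w) || (size v == size w) && lexle v w.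

Lemma lexle_num v w : isdigits v -> size v = size w -> lexle v w ->
  num v <= num w.
Proof.
elim: v w => [|d v IH] [|e w] //= /andP[_ hv] [sz]; rewrite !num_cons sz.
case/orP=> [lt_de|/andP[/eqP-> /(IH _ hv sz)]]; last by rewrite leq_add2l.
by have := num_lt _ hv; rewrite sz; move: (10 ^ _) => b; nia.
Qed.

Lemma strle_num v w : isdigits v -> head 0 w != 0 -> strle v w ->
  num v <= num w.
Proof.
move=> hv hw /orP[sz|/andP[/eqP sz]]; last exact: lexle_num.
apply: ltnW; apply: leq_trans (num_lt _ hv) (leq_trans _ (num_ge _ hw)).
by rewrite leq_pexp2l //; lia.
Qed.

(** * Strings of maximal length *)

(* [w] is lexicographically below the prefix of length [size w] of the infinite
   word [t t t ...]. *)
Fixpoint low (t w : seq nat) : bool :=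
  if w is d :: w' then
    (d < head 0 t) || (d == head 0 t) && low (rot 1 t) w'
  else false.

(** The periodic word separates the two strings: [v] first deviates from it downwards, while [w]
    follows it or first deviates upwards. *)
Lemma low_lexle t v w : low t v -> ~~ low t w -> size v = size w -> lexle v w.
Proof.
elim: v w t => [|d v IH] [|e w] t //= lv lw [sz]; move: lv lw.
have [lt_dt _|//|->] := ltngtP d (head 0 t) => /=.
  by rewrite negb_or -leqNgt => /andP[le_te _]; rewrite (leq_trans lt_dt le_te).
move=> lv; have [//|//|_ /= lw] := ltngtP e (head 0 t).
exact: IH lv lw sz.
Qed.

(** A lengthened substring that starts at the head turns the head into the carry 1; any other one
    leaves the head alone. *)
Lemma grow_cons d w x : isdigits (d :: w) -> x \in grow (d :: w) ->
  4 < d /\ (exists y, x = 1 :: y) \/ (exists2 y, y \in grow w & x = d :: y).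
Proof.
move=> hw; rewrite /grow subst_sub_cons mem_cat => /orP[|/mapP[y hy ->]]; last first.
  by right; exists y.
case/flattenP=> _ /mapP[q _ ->] /mapP[y]; rewrite /growth /=.
case: ltnP => // h4; rewrite inE => /eqP-> ->; left; split=> //.
have [|_ /= hc _ _] := @dblcP (d :: take q w).
  move: hw => /= /andP[-> hw] /=.
  by rewrite -(cat_take_drop q w) isdigits_cat in hw; case/andP: hw.
by rewrite /dbl /= hc h4; eexists.
Qed.

Lemma low_grow t w x : isdigits w -> low t w -> x \in grow w -> low t x.
Proof.
elim: w t x => // d w IH t x hw lw hx; move: lw.
have [[h4 [y ->]]|[y hy ->]] /= := grow_cons _ _ _ hw hx.
  (* The new head 1 is below [d], and [d] is at most the head of [t]. *)
  by case/orP=> [lt_dt|/andP[/eqP<- _]]; apply/orP; left; lia.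
case/orP=> [->//|/andP[-> lw]]; apply/orP; right.
by apply: IH hy => //; case/andP: hw.
Qed.

Definition period := [:: 8; 1; 1; 2].

Definition cand0 : seq (seq nat) := Eval vm_compute in
  undup [seq w <- flatten (map dchoix (dreached 9))
           | (size w == 5) && ~~ low period w].
(** By [low_grow] a low string stays low under lengthening, so the next candidates all come from the
    previous ones. *)
Definition cand1 : seq (seq nat) := Eval vm_compute in
  undup [seq w <- flatten (map grow cand0) | ~~ low period w].
Definition cand2 : seq (seq nat) := Eval vm_compute in
  undup [seq w <- flatten (map grow cand1) | ~~ low period w].
Definition cand3 : seq (seq nat) := Eval vm_compute in
  undup [seq w <- flatten (map grow cand2) | ~~ low period w].

(* The strings of length [k + 5] that may be reached after [k + 10] operations
   and are not [low]. *)
Fixpoint cand (k : nat) (w : seq nat) : bool :=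
  match k with
  | 0 => w \in cand0
  | 1 => w \in cand1
  | 2 => w \in cand2
  | 3 => w \in cand3
  | k'.+4 => (take 4 w == period) && cand k' (drop 4 w)
  end.

Lemma cand_period k w : cand k.+4 w -> exists2 v, w = period ++ v & cand k v.
Proof.
case/andP=> /eqP Ew hw; exists (drop 4 w) => //.
by rewrite -Ew cat_take_drop.
Qed.

Lemma cand_cat k w : cand k.+4 (period ++ w) = cand k w.
Proof.
have -> : cand k.+4 (period ++ w) =
  (take 4 (period ++ w) == period) && cand k (drop 4 (period ++ w)) by [].
by rewrite take_size_cat // drop_size_cat.
Qed.

Fixpoint best (k : nat) : seq nat :=
  match k with
  | 0 => [:: 8; 8; 2; 2; 4]
  | 1 => [:: 8; 1; 6; 4; 4; 8]
  | 2 => [:: 8; 1; 6; 4; 4; 1; 6]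
  | 3 => [:: 8; 1; 6; 4; 4; 1; 1; 2]
  | k'.+4 => period ++ best k'
  end.

Lemma nat_ind4 (P : nat -> Prop) : P 0 -> P 1 -> P 2 -> P 3 ->
  (forall k, P k -> P k.+4) -> forall k, P k.
Proof.
move=> P0 P1 P2 P3 PS k.
suff [] : [/\ P k, P k.+1, P k.+2 & P k.+3] by [].
by elim: k => // k [? ? ? ?]; split=> //; apply: PS.
Qed.

Lemma cand_grow k w x : isdigits w -> cand k w -> x \in grow w ->
  low period x || cand k.+1 x.
Proof.
have finite c j : all (fun w => all (fun x => low period x || cand j x) (grow w)) c ->
    forall w x, w \in c -> x \in grow w -> low period x || cand j x.
  by move=> /allP h v y /h /allP; apply.
elim/nat_ind4: k w x => [||||k IH] w x hw.
- by apply: (finite cand0); vm_compute.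
- by apply: (finite cand1); vm_compute.
- by apply: (finite cand2); vm_compute.
(* Here [cand 4] is [period] followed by a member of [cand0], which closes the cycle. *)
- by apply: (finite cand3); vm_compute.
move=> /cand_period[v Ew hc]; rewrite {}Ew in hw * => hx.
(* Lengthening at the 8 gives the head 1, hence a low string. The digits 1, 1, 2 are too small to
   start a lengthening, so otherwise it takes place inside [v]. *)
have [[_ [y ->]]//|[x1 hx1 ->]] := grow_cons _ _ _ hw hx.
have [[//]|[x2 hx2 ->]] := grow_cons 1 [:: 1, 2 & v] _ hw hx1.
have [[//]|[x3 hx3 ->]] := grow_cons 1 (2 :: v) _ hw hx2.
have [[//]|[y hy ->]] := grow_cons 2 v _ hw hx3.
by have := IH v _ hw hc hy; rewrite (cand_cat k.+1 y).
Qed.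

Lemma cand_best k w : cand k w -> lexle w (best k).
Proof.
have finite c z : all (fun w => lexle w z) c -> forall w, w \in c -> lexle w z.
  by move=> /allP h v /h.
elim/nat_ind4: k w => [||||k IH] w.
- by apply: (finite cand0); vm_compute.
- by apply: (finite cand1); vm_compute.
- by apply: (finite cand2); vm_compute.
- by apply: (finite cand3); vm_compute.
by move=> /cand_period[v -> /IH].
Qed.

Lemma bestP k : [/\ size (best k) = k + 5, isdigits (best k),
  head 0 (best k) != 0 & ~~ low period (best k)].
Proof.
by elim/nat_ind4: k => // k [sz hd _ nl]; split=> //=; rewrite ?sz.
Qed.

Lemma dreached9_choix w x : w \in dreached 9 -> x \in dchoix w ->
  (size x < 5) || (size x == 5) && (low period x || cand 0 x).
Proof.
move=> hw; apply/allP: x; apply/allP: w hw.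
by vm_compute.
Qed.

Lemma reached_long k m : m \in reached (k + 10) ->
  size (digits m) <= k + 5 /\
  (size (digits m) = k + 5 -> low period (digits m) || cand k (digits m)).
Proof.
elim: k m => [|k IH] m.
  move=> /reachedS[n /[dup] /reached_gt0 n_gt0 /reached_dreached hn].
  move=> /(choix_dchoix _ _ n_gt0) /(dreached9_choix _ _ hn) hm; clear hn.
  rewrite add0n; case/orP: hm => [lt5|/andP[/eqP-> h]]; last by split.
  by split=> [|E5]; [exact: ltnW | rewrite E5 in lt5].
rewrite addSn => /reachedS[n hn hm]; have n_gt0 := reached_gt0 _ _ hn.
have [szn hcn] := IH _ hn; have [szm hg] := choix_size _ _ n_gt0 hm.
split=> [|Em]; first by apply: leq_trans szm _; rewrite addSn ltnS.
(* One operation adds at most one digit, so a predecessor of a string of maximal length has maximal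
   length too. *)
have En : size (digits n) = k + 5 by lia.
have {}hg : digits m \in grow (digits n) by apply: hg; lia.
have hd := digits_isdigits n.
case/orP: (hcn En) => [ln|cn]; first by rewrite (low_grow _ _ _ hd ln hg).
exact: cand_grow hd cn hg.
Qed.

(** Shorter strings lose by length, low ones because [best k] is not low, and the remaining
    candidates by [cand_best]. *)
Lemma reached_best k m : m \in reached (k + 10) -> m <= num (best k).
Proof.
move=> /reached_long[sz hm]; have [szb _ hb nl] := bestP k.
rewrite -{1}(num_digits m); apply: strle_num => //; first exact: digits_isdigits.
rewrite /strle szb ltn_neqAle sz andbT; case: eqP => //= Em.
case/orP: (hm Em) => [lm|]; last exact: cand_best.
by apply: low_lexle lm nl _; rewrite szb.
Qed.

(** * The greedy sequence attains the bounds *)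

Definition double_sub v w := exists a s b,
  [/\ v = a ++ s ++ b, w = a ++ dbl s ++ b & head 0 s != 0].

Lemma best_step k : double_sub (best k) (best k.+1).
Proof.
elim/nat_ind4: k => [||||k [a [s [b [E E' hs]]]]].
- by exists [:: 8], [:: 8; 2; 2; 4], [::].
- by exists [:: 8; 1; 6; 4; 4], [:: 8], [::].
- by exists [:: 8; 1; 6; 4; 4; 1], [:: 6], [::].
(* Doubling 644112 gives 1288224; after 81 this reads 8112 followed by 88224, a new period and
   [best 0]. *)
- by exists [:: 8; 1], [:: 6; 4; 4; 1; 1; 2], [::].
by exists (period ++ a), s, b; split=> //; rewrite -catA -?E -?E'.
Qed.

Lemma double_sub_choix v w : isdigits v -> head 0 v != 0 -> double_sub v w ->
  num w \in choix (num v).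
Proof.
move=> hd hh [a [s [b [Ev -> hs]]]]; rewrite {}Ev in hd hh *.
exact: choix_dbl.
Qed.

Lemma r_reached n : r n \in reached n.
Proof.
by elim: n => // n IH; apply/reachedS; exists (r n) => //; case: (r_largest n).
Qed.

(** A squeeze: [r n.+1] is reachable, so it is at most [num w], and [num w] is one operation away
    from [r n]. *)
Lemma r_next n v w : isdigits v -> head 0 v != 0 -> double_sub v w ->
  (forall m, m \in reached n.+1 -> m <= num w) -> r n = num v -> r n.+1 = num w.
Proof.
move=> hv hh vw ub E; apply/eqP; rewrite eqn_leq ub ?r_reached //=.
by have [_] := r_largest n; apply; rewrite E double_sub_choix.
Qed.

Lemma reached_strle n w : head 0 w != 0 -> all (strle^~ w) (dreached n) ->
  forall m, m \in reached n -> m <= num w.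
Proof.
move=> hw /allP h m /reached_dreached /h le; rewrite -(num_digits m).
exact: strle_num (digits_isdigits m) hw le.
Qed.

Lemma r_upto7 n : n < 8 -> r n = nth 0 [:: 1; 2; 4; 8; 16; 112; 224; 448] n.
Proof. by move=> hn; rewrite -r_first (nth_map 0) ?size_iota // nth_iota. Qed.

(** The lead of 512 after seven operations is lost at once: doubling the last digit of 448 gives
    4416, which bounds everything reached in eight. *)
Lemma r8 : r 8 = num [:: 4; 4; 1; 6].
Proof.
apply: (@r_next 7 [:: 4; 4; 8]) => [//|//|||].
- by exists [:: 4; 4], [:: 8], [::].
- by refine (@reached_strle 8 [:: 4; 4; 1; 6] isT _); vm_compute.
- exact: r_upto7.
Qed.

Lemma r9 : r 9 = num [:: 4; 4; 1; 1; 2].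
Proof.
apply: (r_next _ [:: 4; 4; 1; 6]) r8 => [//|//||].
- by exists [:: 4; 4; 1], [:: 6], [::].
- by refine (@reached_strle 9 [:: 4; 4; 1; 1; 2] isT _); vm_compute.
Qed.

Lemma r_best k : r (k + 10) = num (best k).
Proof.
elim: k => [|k IH].
  apply: (r_next _ [:: 4; 4; 1; 1; 2]) r9 => [//|//||].
  (* Doubling the whole of 44112 gives 88224. *)
  - by exists [::], [:: 4; 4; 1; 1; 2], [::].
  - exact: (reached_best 0).
have [_ hd hh _] := bestP k.
apply: r_next IH => [//|//||]; first exact: best_step.
exact: (reached_best k.+1).
Qed.

Lemma R_eq n m : m \in reached n -> (forall k, k \in reached n -> k <= m) ->
  R n = m.
Proof.
move=> hm ub; have [hR ubR] := R_largest n.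
by apply/eqP; rewrite eqn_leq ub ?ubR.
Qed.

(** A path is 1, 2, 4, 8, 16, 112, 56, 512: halving 112 pays off because doubling the 6 of 56 keeps
    the leading 5. *)
Lemma reached7_512 : 512 \in reached 7.
Proof.
by vm_compute.
Qed.

Theorem theorem5 :
  (forall n : nat, n <> 7 -> R n = r n) /\ R 7 = 512.
Proof.
split; last first.
  apply: R_eq reached7_512 _ .
  by refine (@reached_strle 7 [:: 5; 1; 2] isT _); vm_compute.
move=> n n7; apply: R_eq (r_reached n) _.
case: n n7 => [|[|[|[|[|[|[|[|[|[|n]]]]]]]]]] n7.
- by move=> m; rewrite inE => /eqP->.
- by rewrite (r_upto7 1 isT); refine (@reached_strle 1 [:: 2] isT _); vm_compute.
- by rewrite (r_upto7 2 isT); refine (@reached_strle 2 [:: 4] isT _); vm_compute.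
- by rewrite (r_upto7 3 isT); refine (@reached_strle 3 [:: 8] isT _); vm_compute.
- by rewrite (r_upto7 4 isT); refine (@reached_strle 4 [:: 1; 6] isT _); vm_compute.
- by rewrite (r_upto7 5 isT); refine (@reached_strle 5 [:: 1; 1; 2] isT _); vm_compute.
- by rewrite (r_upto7 6 isT); refine (@reached_strle 6 [:: 2; 2; 4] isT _); vm_compute.
- by case: n7.
- by rewrite r8; refine (@reached_strle 8 [:: 4; 4; 1; 6] isT _); vm_compute.
- by rewrite r9; refine (@reached_strle 9 [:: 4; 4; 1; 1; 2] isT _); vm_compute.
rewrite -[n.+4.+4.+2]/(10 + n) addnC r_best; exact: reached_best.
Qed.
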